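(* For every $n \in \mathbb{N}$, \[ s_{\mathbb{T}}(n) \ = \ \binom{n}{3} - \binom{\lfloor n/2 \rfloor}{3} - \binom{\lceil n/2 \rceil}{3}. \]
   Context: $\mathbb{N} = \{0,1,2,\dots\}$ and $\mathbb{T} := \{3\} \cup (\mathbb{N} \setminus 3\mathbb{N})$, where $3\mathbb{N} = \{3k : k \in \mathbb{N}\}$; that is, $\mathbb{T}$ consists of $3$ together with all natural numbers not divisible by $3$. For a finite set $A \subset \mathbb{T}$, define \[ S_{\mathbb{T}}(A) := \mathbb{T} \cap \{a+b+c : a,b,c \in A,\ a<b<c\}, \] and for $n \in \mathbb{N}$ define \[ s_{\mathbb{T}}(n) := \max\{|S_{\mathbb{T}}(A)| : A \subset \mathbb{T},\ |A| = n\}. \] Binomial coefficients satisfy $\binom{m}{3} = 0$ for $m \in \{0,1,2\}$. *)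

(* Defs.v *)
From mathcomp Require Import all_boot finmap.
From mathcomp Require Import boolp.

Set Implicit Arguments.
Unset Strict Implicit.
Unset Printing Implicit Defensive.

Local Open Scope fset_scope.
Local Open Scope nat_scope.

(* T = {3} U (N \ 3N); 0 is a multiple of 3, so it is not in T. *)
Definition inT : pred nat := [pred k | (k == 3) || ~~ (3 %| k)].

(* S_T(A): a triple (a, b, c) is encoded as t = ((a, b), c). *)
Definition sumsT (A : {fset nat}) : {fset nat} :=
  [fset s in [fset t.1.1 + t.1.2 + t.2 | t in (A `*` A) `*` A
                                       & t.1.1 < t.1.2 < t.2] | inT s].

Definition attainedT (n : nat) : pred nat := [pred m |
  `[< exists A : {fset nat},
        [/\ {subset A <= inT}, #|` A| = n & #|` sumsT A| = m] >]].

Lemma attainedT_ex (n : nat) : exists m, attainedT n m.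
Proof.
pose A := [fset (3 * i + 1)%N | i in iota 0 n].
exists #|` sumsT A|; apply/asboolP; exists A; split=> //.
  move=> x /imfsetP[i _ ->] /=.
  by rewrite !inE dvdn_addr ?dvdn_mulr // orbT.
rewrite card_imfset /=; first by rewrite undup_id ?iota_uniq // size_iota.
by move=> i j /= /addIn /eqP; rewrite eqn_pmul2l // => /eqP.
Qed.

Lemma attainedT_bound (n m : nat) : attainedT n m -> m <= n * n * n.
Proof.
move=> /asboolP[A [_ <- <-]].
rewrite -(size_allpairs addn A A) -(size_allpairs addn).
apply: uniq_leq_size (fset_uniq _) _ => s.
rewrite !inE => /andP[/imfsetP[t /=]].
rewrite !inE => /andP[/andP[/andP[At1 At2] At3] _] -> _.
by apply: allpairs_f => //; apply: allpairs_f.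
Qed.

(* s_T(n), the maximum of |S_T(A)| over the n-element subsets A of T. The
   cubic bound only witnesses that the maximum exists; it does not affect its
   value. *)
Definition sT (n : nat) : nat := ex_maxn (attainedT_ex n) (@attainedT_bound n).

Lemma mem_sumsT (A : {fset nat}) (s : nat) :
  reflect (exists a b c, [/\ a \in A, b \in A, c \in A, a < b < c
                           & s = a + b + c] /\ inT s)
          (s \in sumsT A).
Proof.
apply: (iffP idP).
  rewrite !inE => /andP[/imfsetP[[[a b] c] /=]].
  rewrite !inE /= => /andP[/andP[/andP[Aa Ab] Ac] abc] -> Ts.
  by exists a, b, c; split.
move=> [a [b [c [[Aa Ab Ac abc ->] Ts]]]].
rewrite !inE; apply/andP; split=> //.
by apply/imfsetP; exists (a, b, c); rewrite //= !inE /= Aa Ab Ac.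
Qed.

(* Main.v *)
Require Import Defs.
From mathcomp Require Import all_boot all_order all_algebra.
From mathcomp Require Import finmap boolp zify.

(** For three distinct elements of T the sum exceeds 3, so it lies in T exactly
    when it is not divisible by 3. Split A by residue mod 3 into p elements
    congruent to 1, q congruent to 2, and z <= 1 elements divisible by 3 (namely
    3 itself). The 3-subsets with sum divisible by 3 number at least
    C(p,3) + C(q,3) + z p q. If z = 1 this is at least C(p+1,3) + C(q,3) for
    p <= q, so in all cases convexity of C(-,3) gives the upper bound. The set
    of all 3 * 2^i + 1 + (i mod 2), i < n, attains it: all sums of three
    elements that are not divisible by 3 are distinct, by uniqueness of binary
    expansions. *)

(** * Three-element sets and divisibility of their sums by 3 *)

Section TripleSums.
Variables (I : finType) (v : I -> nat).
Hypothesis v_inj : injective v.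

Definition triples : {set {set I}} := [set B : {set I} | #|B| == 3].
Definition vsum (B : {set I}) : nat := \sum_(x in B) v x.
Definition good_triples := [set B in triples | ~~ (3 %| vsum B)].
Definition bad_triples := [set B in triples | 3 %| vsum B].
Definition values : {fset nat} := [fset v x | x in I]%fset.

Lemma card_good_bad : #|good_triples| + #|bad_triples| = 'C(#|I|, 3).
Proof.
rewrite -card_draws -/triples.
rewrite addnC -(cardsID [set B | 3 %| vsum B] triples).
by congr (_ + _); apply: eq_card => B; rewrite !inE // andbC.
Qed.

Lemma triple_set (x y z : I) : v x < v y < v z ->
  [set x; y; z] \in triples /\ vsum [set x; y; z] = v x + v y + v z.
Proof.
move=> /andP[xy yz].
have nxy : x != y by apply: contraTneq xy => ->; rewrite ltnn.
have nyz : y != z by apply: contraTneq yz => ->; rewrite ltnn.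
have nxz : x != z by apply: contraTneq (ltn_trans xy yz) => ->; rewrite ltnn.
have nz : z \notin [set x; y].
  by rewrite !inE negb_or eq_sym nxz eq_sym nyz.
split; first by rewrite inE setUC cardsU1 nz cards2 nxy.
by rewrite /vsum setUC big_setU1 //= big_setU1 ?inE //= big_set1 addnC.
Qed.

Lemma triplesP (B : {set I}) : B \in triples ->
  exists x y z, v x < v y < v z /\ B = [set x; y; z].
Proof.
rewrite inE => /eqP B3.
(* Sort [B] by [v]; injectivity of [v] makes the resulting order strict. *)
pose r := relpre v leq.
have r_total : total r by move=> x y; apply: leq_total.
pose s := sort r (enum B).
have s_mem x : (x \in s) = (x \in B) by rewrite mem_sort mem_enum.
have s_uniq : uniq s by rewrite sort_uniq enum_uniq.
have s_sorted : sorted r s by apply: sort_sorted.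
have : size s = 3 by rewrite size_sort -cardE.
move: s s_mem s_uniq s_sorted => [|x [|y [|z [|]]]] // s_mem.
rewrite /= !inE negb_or !andbT => /andP[/andP[nxy _] nyz] /andP[rxy ryz] _.
exists x, y, z; split.
  by rewrite !ltn_neqAle !(inj_eq v_inj) nxy nyz; apply/andP.
by apply/setP=> w; rewrite -s_mem !inE orbA.
Qed.

Lemma sumsT_values : {subset values <= inT} ->
  sumsT values =i [fset vsum B | B in good_triples]%fset.
Proof.
move=> vT s; apply/mem_sumsT/imfsetP => /=.
  move=> [a [b [c [[/imfsetP[x _ ->] /imfsetP[y _ ->] /imfsetP[z _ ->]]]]]].
  move=> xyz -> sT; have [B3 BE] := triple_set _ _ _ xyz.
  exists [set x; y; z]; rewrite // inE B3 BE /=.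
  (* Distinct naturals with sum 3 are 0, 1, 2, and 0 is not in T. *)
  case/orP: sT => // /eqP s3.
  have /vT : v x \in values by apply/imfsetP; exists x.
  by have -> : v x = 0 by lia.
move=> [B]; rewrite inE => /andP[/triplesP[x [y [z [xyz ->]]]]].
have [_ ->] := triple_set _ _ _ xyz => n3 ->.
exists (v x), (v y), (v z); split; last by rewrite /inT /= n3 orbT.
by split=> //; apply/imfsetP; [exists x|exists y|exists z].
Qed.

Lemma card_sumsT_le : {subset values <= inT} ->
  #|` sumsT values| <= #|good_triples|.
Proof.
move=> vT; have /fsetP-> := sumsT_values vT.
by rewrite (leq_trans (leq_imfset_card _ _ _)) //= cardE.
Qed.

Lemma card_sumsT_inj : {subset values <= inT} ->
  {in good_triples &, injective vsum} ->
  #|` sumsT values| = #|good_triples|.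
Proof.
move=> vT sum_inj; have /fsetP-> := sumsT_values vT.
by rewrite card_in_imfset //= cardE.
Qed.

Definition residue r : {set I} := [set x | v x %% 3 == r].

Lemma card_residues : #|residue 0| + #|residue 1| + #|residue 2| = #|I|.
Proof.
rewrite -!sum1_card big_mkcond [X in _ + X + _]big_mkcond.
rewrite [X in _ + _ + X]big_mkcond -!big_split /=; apply: eq_bigr => x _.
by rewrite !inE; case: (v x %% 3) (ltn_mod (v x) 3) => [|[|[|]]].
Qed.

Lemma residue_bad r (B : {set I}) :
  B \subset residue r -> #|B| = 3 -> B \in bad_triples.
Proof.
move=> /subsetP BP B3; rewrite !inE B3 eqxx /= /vsum /dvdn -modn_summ.
rewrite (eq_bigr (fun=> r)) => [|x /BP]; last by rewrite inE => /eqP.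
by rewrite sum_nat_const B3 modnMr.
Qed.

Lemma transversal_bad z x y :
  z \in residue 0 -> x \in residue 1 -> y \in residue 2 ->
  [set z; x; y] \in bad_triples.
Proof.
rewrite !inE => /eqP z0 /eqP x1 /eqP y2.
have ny : y \notin [set z; x].
  by rewrite !inE; apply/norP; split; apply/eqP=> E; move: y2; rewrite E ?z0 ?x1.
have nx : z != x by apply: contra_eqN x1 => /eqP<-; rewrite z0.
rewrite setUC cardsU1 ny cards2 nx /= /vsum big_setU1 //= big_setU1 ?inE //=.
by rewrite big_set1; lia.
Qed.

(** The terms count disjoint families: triples inside class 1, triples inside class 2, and
    transversals through one fixed [z] of class 0. A single [z] suffices because T has only one
    multiple of 3. *)
Lemma card_bad_ge : 'C(#|residue 1|, 3) + 'C(#|residue 2|, 3)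
  + (0 < #|residue 0|) * (#|residue 1| * #|residue 2|) <= #|bad_triples|.
Proof.
pose D r := [set B : {set I} | B \subset residue r & #|B| == 3].
have D_sub r : D r \subset bad_triples.
  by apply/subsetP=> B; rewrite inE => /andP[Br /eqP]; apply: residue_bad Br.
have D12 : [disjoint D 1 & D 2].
  apply/pred0P=> B /=; rewrite !inE; apply/negP.
  move=> /andP[/andP[/subsetP B1 /eqP B3] /andP[/subsetP B2 _]].
  have /card_gt0P[x xB] : 0 < #|B| by rewrite B3.
  by move: (B1 x xB) (B2 x xB); rewrite !inE => /eqP->.
have D12_card : #|D 1 :|: D 2| = 'C(#|residue 1|, 3) + 'C(#|residue 2|, 3).
  by rewrite cardsU disjoint_setI0 // cards0 subn0 !cards_draws.
have D12_sub : D 1 :|: D 2 \subset bad_triples by rewrite subUset !D_sub.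
case: posnP => [_|/card_gt0P[z z0]].
  by rewrite addn0 -D12_card subset_leq_card.
pose t (u : I * I) := [set z; u.1; u.2].
pose W := t @: setX (residue 1) (residue 2).
have t_mem u w : w \in t u -> [|| v w %% 3 == 0, w == u.1 | w == u.2].
  by rewrite !inE => /orP[/orP[/eqP->|->]|->]; rewrite ?orbT //;
    move: z0; rewrite inE => ->.
have W_card : #|W| = #|residue 1| * #|residue 2|.
  rewrite card_in_imset ?cardsX // => -[x y] [x' y'] uX u'X E.
  (* Residues separate the coordinates: [x], of residue 1, is neither [z] nor [y'], so it is [x'];
     likewise for [y]. *)
  have xE : x \in t (x', y') by rewrite -E !inE eqxx !orbT.
  have yE : y \in t (x', y') by rewrite -E !inE eqxx !orbT.
  move: (t_mem _ _ xE) (t_mem _ _ yE) uX u'X; rewrite !inE /=.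
  move=> xo yo /andP[/eqP x1 /eqP y2] /andP[/eqP x'1 /eqP y'2].
  move: xo yo; rewrite x1 y2 /=.
  move=> /orP[/eqP->|/eqP xy']; last by rewrite xy' y'2 in x1.
  by move=> /orP[/eqP yx'|/eqP->//]; rewrite yx' x'1 in y2.
have W_sub : W \subset bad_triples.
  apply/subsetP=> _ /imsetP[[x y] /setXP[x1 y2] ->].
  exact: transversal_bad.
have DW : [disjoint D 1 :|: D 2 & W].
  apply/pred0P=> B /=; apply/negP=> /andP[BD /imsetP[[x y] /setXP[x1 y2] BE]].
  move: z0 x1; rewrite !inE => /eqP z0 /eqP x1.
  have zB : z \in B by rewrite BE !inE eqxx.
  by case/setUP: BD; rewrite inE => /andP[/subsetP/(_ z zB) + _];
    rewrite inE z0.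
rewrite mul1n -D12_card -W_card -(leq_add2r #|(D 1 :|: D 2) :&: W|).
rewrite -cardsUI disjoint_setI0 // cards0 !addn0.
by rewrite subset_leq_card // subUset D12_sub.
Qed.
End TripleSums.

(** * Convexity of binomials and the lower bound on bad triples *)

(** By Pascal's rule the increments of ['C(-, 3)] are values of ['C(-, 2)], which is monotone. *)
Lemma bin3_convex m k : 'C(m.+1, 3) + 'C((m + k).+1, 3)
  <= 'C(m, 3) + 'C((m + k).+2, 3).
Proof.
rewrite (binS (m + k).+1) (binS m).
have : 'C(m, 2) <= 'C((m + k).+1, 2) by apply: leq_bin2l; lia.
lia.
Qed.

(** Moving both arguments one step towards each other keeps their sum and, by convexity, does not
    increase the right-hand side. The gap [k] shrinks by two, down to 0 or 1, where the arguments
    are the two halves. *)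
Lemma bin3_balanced p q :
  'C((p + q)./2, 3) + 'C(uphalf (p + q), 3) <= 'C(p, 3) + 'C(q, 3).
Proof.
wlog pq : p q / p <= q.
  by move=> H; case: (leqP p q) => [|/ltnW] /H //;
    rewrite (addnC p) ['C(p, 3) + _]addnC.
rewrite -(subnKC pq); move: (q - p) => k {q pq}.
have [m] := ubnP k; elim: m k p => // m IH [|[|k]] p km.
- by rewrite addn0 addnn doubleK uphalf_double.
- by rewrite addnA addnn !addn1 /= uphalf_double doubleK.
have -> : p + (p + k.+2) = p.+1 + (p.+1 + k) by lia.
apply: leq_trans (IH k p.+1 _) _; first lia.
by rewrite !addnS addSn bin3_convex.
Qed.

Lemma card_bad_balanced (I : finType) (v : I -> nat) : injective v ->
  {subset values _ v <= inT} ->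
  'C(#|I|./2, 3) + 'C(uphalf #|I|, 3) <= #|bad_triples _ v|.
Proof.
move=> v_inj vT; apply: leq_trans (card_bad_ge _ v).
rewrite -(card_residues _ v).
set p := #|residue _ v 1|; set q := #|residue _ v 2|.
have : #|residue _ v 0| <= 1.
  apply/card_le1_eqP => x y; rewrite !inE => x0 y0; apply: v_inj.
  have v3 u : v u %% 3 == 0 -> v u = 3.
    have /vT : v u \in values _ v by apply/imfsetP; exists u.
    by rewrite /inT !inE /dvdn => /orP[/eqP|/negP].
  by rewrite (v3 x x0) (v3 y y0).
case: #|residue _ v 0| => [_|[_|//]]; first by rewrite add0n addn0 bin3_balanced.
(* The element 3 is counted into the smaller class: this adds ['C(a, 2)] triples, no more than the
   [a * b] transversals. *)
have step a b : a <= b -> 'C(a.+1, 3) + 'C(b, 3) <= 'C(a, 3) + 'C(b, 3) + a * b.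
  move=> ab; rewrite binS; have : 'C(a, 2) <= a * b.
    by rewrite bin2 leq_half_double; nia.
  lia.
rewrite mul1n; have [pq|/ltnW qp] := leqP p q.
  by apply: leq_trans (step _ _ pq); rewrite addSn -addSn bin3_balanced.
have := step _ _ qp; have := bin3_balanced q.+1 p.
by rewrite addSn add1n addSn [q + p]addnC [q * p]mulnC; lia.
Qed.

(** * Binary expansions and parity counts *)

(** Parity reads off the lowest digit; the remaining sum is twice a shorter expansion. *)
Lemma binary_inj n (b c : 'I_n -> bool) :
  \sum_(i < n) b i * 2 ^ i = \sum_(i < n) c i * 2 ^ i -> b =1 c.
Proof.
elim: n b c => [|n IH] b c; first by move=> _ [].
rewrite !big_ord_recl /= !expn0 !muln1.
have E (d : 'I_n.+1 -> bool) : \sum_(i < n) d (lift ord0 i) * 2 ^ bump 0 i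
    = (\sum_(i < n) d (lift ord0 i) * 2 ^ i).*2.
  rewrite -mul2n big_distrr; apply: eq_bigr => i _ /=.
  by rewrite /bump /= expnS mulnCA.
rewrite !E => H i.
have bc0 : b ord0 = c ord0.
  by have := congr1 odd H; rewrite !oddD !odd_double !oddb !addbF.
have /IH bcS : \sum_(i < n) b (lift ord0 i) * 2 ^ i
    = \sum_(i < n) c (lift ord0 i) * 2 ^ i.
  by move: H; rewrite bc0 => /addnI /double_inj.
by case: (unliftP ord0 i) => [j|] ->.
Qed.

Lemma sum_pow2_inj n : injective (fun B : {set 'I_n} => \sum_(i in B) 2 ^ i).
Proof.
move=> B C; rewrite /= [LHS]big_mkcond [RHS]big_mkcond => H; apply/setP.
by apply: binary_inj; move: H; congr (_ = _); apply: eq_bigr => i _;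
  rewrite -[in RHS]/(i \in _); case: (i \in _); rewrite ?mul1n.
Qed.

Lemma card_odd_ord n : #|[set i : 'I_n | odd i]| = n./2.
Proof.
elim: n => [|n IH]; first by apply: eq_card0 => -[].
rewrite -sum1dep_card big_mkcond big_ord_recr /= -big_mkcond /=.
by rewrite sum1dep_card IH uphalf_half addnC; case: (odd n).
Qed.

Lemma card_even_ord n : #|[set i : 'I_n | ~~ odd i]| = uphalf n.
Proof.
elim: n => [|n IH]; first by apply: eq_card0 => -[].
rewrite -sum1dep_card big_mkcond big_ord_recr /= -big_mkcond /=.
by rewrite sum1dep_card IH uphalf_half; case: (odd n) => /=; lia.
Qed.

(** * The extremal set *)

Section Extremal.
Variable n : nat.

(** The last term gives residue 1 at even and 2 at odd indices, so the two classes are balanced and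
    no value is a multiple of 3. The powers of 2 let a sum record its index set. *)
Definition spread (i : 'I_n) : nat := 3 * 2 ^ i + (odd i).+1.

Lemma spread_inj : injective spread.
Proof.
move=> i j; rewrite /spread => E; apply: val_inj.
by apply: (@expnI 2) => //; move: (odd i) (odd j) E => [] [] /=; lia.
Qed.

Lemma spread_inT : {subset values _ spread <= inT}.
Proof.
move=> _ /imfsetP[i _ ->]; rewrite inE /= /spread dvdn_addr ?dvdn_mulr //.
by case: (odd i); rewrite orbT.
Qed.

(** The successor under the factor 3 collects a constant 1 from each of the three values; modulo 3
    only the number of odd indices remains. *)
Lemma vsum_spread (B : {set 'I_n}) : #|B| = 3 ->
  vsum _ spread B = 3 * (\sum_(i in B) 2 ^ i).+1 + #|B :&: [set i : 'I_n | odd i]|.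
Proof.
move=> B3; rewrite /vsum /spread big_split /= -big_distrr /=.
under [X in _ + X]eq_bigr do rewrite -add1n.
rewrite big_split /= sum1_card B3 mulnS addnCA addnA; congr (_ + _).
rewrite -sum1_card big_mkcond [RHS]big_mkcond; apply: eq_bigr => i _.
by rewrite !inE; case: (i \in B); case: (odd i).
Qed.

(** In a good triple the number of odd indices is 1 or 2, hence equals the remainder of the sum
    modulo 3, and the quotient determines the sum of powers of 2. The counts 0 and 3, which share a
    remainder, occur only in bad triples. *)
Lemma vsum_spread_inj : {in good_triples _ spread &, injective (vsum _ spread)}.
Proof.
move=> B C; rewrite !inE => /andP[/eqP B3 nB] /andP[/eqP C3 nC].
move: nB nC; rewrite !vsum_spread //.
have := subset_leq_card (subsetIl B [set i : 'I_n | odd i]).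
have := subset_leq_card (subsetIl C [set i : 'I_n | odd i]).
rewrite B3 C3 => C_le B_le nB nC E.
apply: sum_pow2_inj => /=; move: B_le C_le nB nC E.
move: (\sum_(i in B) _) (\sum_(i in C) _) #|_ :&: _| #|_ :&: _| => b c k l.
lia.
Qed.

(** Divisibility by 3 forces the number of odd indices to be 0 or 3, so a bad triple has all its
    indices of one parity. *)
Lemma card_bad_spread :
  #|bad_triples _ spread| <= 'C(n./2, 3) + 'C(uphalf n, 3).
Proof.
rewrite -card_odd_ord -card_even_ord -!cards_draws.
apply: leq_trans (leq_card_setU _ _); apply: subset_leq_card.
apply/subsetP=> B; rewrite !inE => /andP[/eqP B3].
rewrite vsum_spread // B3 eqxx !andbT.
have := subset_leq_card (subsetIl B [set i : 'I_n | odd i]); rewrite B3 => le3.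
rewrite dvdn_addr ?dvdn_mulr // => d3.
set m := #|_| in le3 d3.
have [E|E] : m = 0 \/ m = 3 by lia.
  apply/orP; right; apply/subsetP=> i iB; rewrite inE; apply/negP=> oi.
  by move: (cards0_eq E) => /setP/(_ i); rewrite !inE iB oi.
apply/orP; left; apply/setIidPl/eqP.
by rewrite eqEcard subsetIl -/m E B3.
Qed.

Lemma card_sumsT_spread :
  'C(n, 3) <= #|` sumsT (values _ spread)| + ('C(n./2, 3) + 'C(uphalf n, 3)).
Proof.
rewrite (card_sumsT_inj _ _ spread_inj spread_inT vsum_spread_inj).
rewrite -[in 'C(n, 3)](card_ord n) -(card_good_bad _ spread).
by rewrite leq_add2l card_bad_spread.
Qed.
End Extremal.

(** * The value of the maximum *)

Lemma card_sumsT_upper (A : {fset nat}) : {subset A <= inT} ->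
  #|` sumsT A| + ('C(#|` A|./2, 3) + 'C(uphalf #|` A|, 3)) <= 'C(#|` A|, 3).
Proof.
(* The set [A] itself, as a finite type, serves as index type, with [v] the inclusion. *)
move=> AT; pose v (x : A) := val x.
have AE : values _ v = A.
  apply/fsetP=> x; apply/imfsetP/idP => [[y _ ->]|xA]; first exact: valP.
  by exists [` xA]%fset.
have vT : {subset values _ v <= inT} by rewrite AE.
rewrite -{1}AE !(cardfE A) -(card_good_bad _ v) leq_add //.
  exact: card_sumsT_le _ _ val_inj vT.
exact: card_bad_balanced _ _ val_inj vT.
Qed.

Local Open Scope ring_scope.

Theorem proposition2 (n : nat) :
  (sT n)%:Z = 'C(n, 3)%:Z - 'C(n./2, 3)%:Z - 'C(uphalf n, 3)%:Z.
Proof.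
(* The additive form over the naturals avoids truncated subtraction. *)
suff : (sT n + ('C(n./2, 3) + 'C(uphalf n, 3)) = 'C(n, 3))%N by lia.
rewrite /sT; case: ex_maxnP => m /asboolP[A [AT An <-]] m_max.
apply/eqP; rewrite eqn_leq -{1 2 3}An card_sumsT_upper //=.
(* For the other inequality, the extremal set competes in the maximum. *)
apply: leq_trans (@card_sumsT_spread n) _; rewrite leq_add2r; apply: m_max.
apply/asboolP; exists (values _ (@spread n)); split=> //.
  exact: spread_inT.
by rewrite card_imfset ?size_enum_ord //=; apply: spread_inj.
Qed.
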